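(* Fix $\tilde{\bm x}\in\mathcal X$ and $f_n^*\in\mathbb R$. Let $Z(\tilde{\bm x})=Z_1(\tilde{\bm x})Z_2(\tilde{\bm x})+z_0(\tilde{\bm x})$, where $Z_1(\tilde{\bm x})\sim N(\mu_1(\tilde{\bm x}),\sigma_1^2(\tilde{\bm x}))$ with $\sigma_1^2(\tilde{\bm x})=1$ and $Z_2(\tilde{\bm x})\sim N(\mu_2(\tilde{\bm x}),\sigma_2^2(\tilde{\bm x}))$ with $\sigma_2(\tilde{\bm x})>0$ are independent and $z_0(\tilde{\bm x})\in\mathbb R$ is deterministic. Then the nested expected improvement evaluated under $Z$, namely $\mathrm E_Z\big[(f_n^*-Z(\tilde{\bm x}))_+\big]$, equals $$\int_{-\infty}^{\infty}\Big\{\big(f_n^*-z_0(\tilde{\bm x})-t\mu_2(\tilde{\bm x})\big)\,\phi_N\big(u_1(t,\tilde{\bm x})\big)\,\Phi_N\big(u_2(f_n^*,t,\tilde{\bm x})\big)+|t|\,\sigma_2(\tilde{\bm x})\,\phi_N\big(u_1(t,\tilde{\bm x})\big)\,\phi_N\big(u_2(f_n^*,t,\tilde{\bm x})\big)\Big\}\,dt,$$ where $$u_1(t,\tilde{\bm x})=\frac{t-\mu_1(\tilde{\bm x})}{\sigma_1(\tilde{\bm x})},\qquad u_2(z,t,\tilde{\bm x})=\frac{z-z_0(\tilde{\bm x})-t\mu_2(\tilde{\bm x})}{|t|\,\sigma_2(\tilde{\bm x})}.$$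
   Context: $(a)_+=\max\{a,0\}$; $\Phi_N$ and $\phi_N$ are the cumulative distribution function and probability density function of the standard normal distribution. In the application, $f_n^*$ is the smallest of the outputs of a nested computer model $f(\tilde{\bm x})=g(\bm h^T(x),x')$, $\tilde{\bm x}=(x,x')$, observed so far, and $Z(\tilde{\bm x})$ is the approximation of the (non-Gaussian) posterior of $f(\tilde{\bm x})$ given the data $D_n$, with parameters as follows. If the Gaussian process posteriors of the inner model $\bm h$ ($\mathbb R^p$-valued) and outer model $g$ are $N(\hat{\bm h}_n(x),\bm s_h^2(x))$ and $N(\hat g_n(\bm h^T,x'),s_g^2(\bm h^T,x'))$, put $\bm c_h^T=\frac{\partial\hat g_n}{\partial\bm h}(\hat{\bm h}_n^T(x),x')\bm s_h(x)$, $c_g=s_g(\hat{\bm h}_n^T(x),x')$, $\bm c_{h,g}^T=\frac{\partial s_g}{\partial\bm h}(\hat{\bm h}_n^T(x),x')\bm s_h(x)$; then $\mu_1=c_g/\sqrt{\bm c_{h,g}^T\bm c_{h,g}}$, $\mu_2=\sqrt{\bm c_h^T\bm c_h}$, $\sigma_1^2=1$, $\sigma_2^2=\bm c_{h,g}^T\bm c_{h,g}$ and $z_0=\hat g_n(\hat{\bm h}_n^T(x),x')-\mu_1\mu_2$. The nested expected improvement is $\mathrm{NEI}_n(\tilde{\bm x})=\mathrm E_{f|D_n}(f_n^*-f(\tilde{\bm x}))_+$, and here it is evaluated with $Z(\tilde{\bm x})$ in place of $f(\tilde{\bm x})|D_n$. The integrand is understood for $t\neq0$ (a set of full measure). *)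

(* Defs.v *)
From HB Require Import structures.
From mathcomp Require Import all_boot all_order all_algebra.
From mathcomp Require Import all_classical all_reals all_analysis.
Set Implicit Arguments.
Unset Strict Implicit.
Unset Printing Implicit Defensive.
Import Order.TTheory GRing.Theory Num.Theory.
Import numFieldNormedType.Exports.
Local Open Scope classical_set_scope.
Local Open Scope ring_scope.

Definition phiN {R : realType} (x : R) : R := normal_pdf 0 1 x.

(* [fine] loses nothing: [normal_prob 0 1] is a probability measure. *)
Definition PhiN {R : realType} (x : R) : R :=
  fine (normal_prob 0 1 `]-oo, x]).

(* X ~ N(m, s^2); as in [normal_prob], s is the standard deviation. The two
   set functions are compared on measurable sets only, since their values
   elsewhere carry no meaning. *)
Definition normal_law d (T : measurableType d) (R : realType)
    (P : probability T R) (X : {RV P >-> R}) (m s : R) : Prop :=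
  forall A : set R, measurable A -> distribution P X A = normal_prob m s A.

Definition independent_RV d (T : measurableType d) (R : realType)
    (P : probability T R) (X Y : {RV P >-> R}) : Prop :=
  forall A B : set R, measurable A -> measurable B ->
    P ((X @^-1` A) `&` (Y @^-1` B)) = (P (X @^-1` A) * P (Y @^-1` B))%E.

(* E (a)_+ for a = fstar - Z, with the value of the objective at the point of
   interest distributed as Z under P. *)
Definition NEI d (T : measurableType d) (R : realType)
    (P : probability T R) (fstar : R) (Z : T -> R) : \bar R :=
  ('E_P[fun w => Num.max (fstar - Z w)%R 0%R])%E.

Definition u1 {R : realType} (mu1 sigma1 t : R) : R := (t - mu1) / sigma1.

Definition u2 {R : realType} (mu2 sigma2 z0 z t : R) : R :=
  (z - z0 - t * mu2) / (`|t| * sigma2).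

(* Main.v *)
Require Import Defs.
From HB Require Import structures.
From mathcomp Require Import all_boot all_order all_algebra.
From mathcomp Require Import all_classical all_reals all_analysis.
From mathcomp Require Import measurable_realfun lra ring.
Set Implicit Arguments.
Unset Strict Implicit.
Unset Printing Implicit Defensive.
Import Order.TTheory GRing.Theory Num.Theory.
Import numFieldNormedType.Exports.
Local Open Scope classical_set_scope.
Local Open Scope ring_scope.

(** By independence and Tonelli, E (f* - Z)_+ is the integral over t, against the
    N(mu1, 1) density, of E (c - t Z2)_+ with c = f* - z0.  Standardizing
    Z2 = mu2 + sigma2 W and using the symmetry of W, the inner expectation is
    E (A + B W)_+ with A = c - t mu2 and B = |t| sigma2, which for B > 0 equals
    A Phi(A/B) + B phi(A/B) since phi'(w) = - w phi(w). *)

(** The change of variables produces a Radon-Nikodym derivative, determined only almost everywhere.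
    It agrees almost everywhere with [normal_pdf m s] because both have the same integral over every
    measurable set. *)
Lemma ge0_integral_normal_prob (R : realType) (m s : R) (f : R -> \bar R) :
  measurable_fun [set: R] f -> (forall x, 0 <= f x)%E ->
  (\int[normal_prob m s]_x f x =
   \int[lebesgue_measure]_x (f x * (normal_pdf m s x)%:E))%E.
Proof.
move=> mf f0; have dom := normal_prob_dominates m s.
rewrite -(Radon_Nikodym_SigmaFinite.change_of_variables dom)//.
have mg := measurable_int _ (Radon_Nikodym_SigmaFinite.f_integrable dom).
have mpdf : measurable_fun [set: R] (EFin \o normal_pdf m s).
  by apply/measurable_EFinP; exact: measurable_normal_pdf.
apply: ge0_ae_eq_integral => //.
- exact: emeasurable_funM.
- exact: emeasurable_funM.
- by move=> x _; rewrite mule_ge0// Radon_Nikodym_SigmaFinite.f_ge0.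
- by move=> x _; rewrite mule_ge0// lee_fin normal_pdf_ge0.
apply: ae_eqe_mul2l; apply: integral_ae_eq => //.
- exact: Radon_Nikodym_SigmaFinite.f_integrable.
- by move=> A _ mA; rewrite -Radon_Nikodym_SigmaFinite.f_integral.
Qed.

(** Independence says that the joint law of [(X, Y)] agrees with the product of the marginal laws on
    rectangles, and this determines it on all measurable sets; Tonelli does the rest. *)
Lemma ge0_integral_independent_RV d (T : measurableType d) (R : realType)
    (P : probability T R) (X Y : {RV P >-> R}) (f : R * R -> \bar R) :
  independent_RV X Y -> measurable_fun [set: R * R] f ->
  (forall xy, 0 <= f xy)%E ->
  (\int[P]_w f (X w, Y w) =
   \int[distribution P X]_x \int[distribution P Y]_y f (x, y))%E.
Proof.
move=> indXY mf f0.
have mXY : measurable_fun [set: T] (fun w => (X w, Y w)).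
  by apply: measurable_fun_pair.
pose XYmixin := isMeasurableFun.Build _ _ _ _ _ mXY.
pose XY : {mfun T >-> (R * R)%type} := HB.pack (fun w => (X w, Y w)) XYmixin.
rewrite -[LHS](@ge0_integral_distribution _ _ _ _ _ P XY)//.
rewrite -[RHS](@fubini_tonelli1 _ _ _ _ _ (distribution P X) (distribution P Y))//.
apply: eq_measure_integral => A mA _; apply/esym.
by apply: product_measure_unique => // B C mB mC; exact: indXY.
Qed.

(* [distribution P X] and [normal_prob m s] live on copies of the Borel space of
   R with different displays, so they are compared through a pushforward by the
   identity. *)
Lemma ge0_integral_normal_law d (T : measurableType d) (R : realType)
    (P : probability T R) (X : {RV P >-> R}) (m s : R) (f : R -> \bar R) :
  normal_law X m s -> measurable_fun [set: R] f -> (forall x, 0 <= f x)%E ->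
  (\int[distribution P X]_x f x = \int[normal_prob m s]_x f x)%E.
Proof.
move=> Xms mf f0; pose idR : measurableTypeR R -> R := idfun.
have midR : measurable_fun setT idR by exact: measurable_id.
rewrite -[RHS](@ge0_integral_pushforward _ _ _ _ _ idR midR
  (normal_prob m s) setT f)//.
by apply: eq_measure_integral => A mA _; exact: Xms.
Qed.

(** * The standard normal density and distribution function *)

Section standard_normal.
Variable R : realType.
Local Notation mu := (@lebesgue_measure R).
Implicit Types a b w x : R.

Lemma phiNE x : phiN x = normal_peak 1 * expR (- x ^+ 2 / 2).
Proof.
by rewrite /phiN (normal_pdfE _ (oner_neq0 R)) /normal_fun subr0 expr1n.
Qed.

Lemma phiN_ge0 x : 0 <= phiN x. Proof. exact: normal_pdf_ge0. Qed.

Lemma phiN_even x : phiN (- x) = phiN x.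
Proof. by rewrite !phiNE sqrrN. Qed.

Lemma continuous_phiN : continuous (@phiN R).
Proof. exact/continuous_normal_pdf/oner_neq0. Qed.

Lemma is_derive_phiN x : is_derive x 1 (@phiN R) (- x * phiN x).
Proof.
have -> : @phiN R = (fun y => normal_peak 1 * expR (- y ^+ 2 / 2)).
  by apply/funext => y; rewrite phiNE.
apply: is_derive_eq.
by rewrite /GRing.scale /=; field.
Qed.

Lemma cvg_phiN : phiN x @[x --> +oo] --> (0 : R).
Proof.
have -> : @phiN R = (fun y => normal_peak 1 * expR (- (y ^+ 2 / 2))).
  by apply/funext => y; rewrite phiNE mulNr.
rewrite -[X in _ --> X](mulr0 (normal_peak 1)).
apply: cvgM; first exact: cvg_cst.
apply: (cvg_comp (fun y : R => y ^+ 2 / 2) (fun y => expR (- y))).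
  by apply: gt0_cvgMly => //; exact: cvgr_expr2.
exact: cvgr_expR.
Qed.

Lemma is_derive_PhiN x : is_derive x 1 (@PhiN R) (phiN x).
Proof.
have xx1 : x < x + 1 by rewrite ltrDl.
(* The end point [x + 1] puts [x] in the interior of the half-line, as differentiating there
   requires. *)
have iphi : mu.-integrable `]-oo, (x + 1)%R] (EFin \o @phiN R).
  by apply: (integrableS _ _ (subsetT _)) => //; exact: integrable_normal_pdf.
have [dPhi PhiE] := continuous_FTC1 xx1 iphi (ltNyr _) (@continuous_phiN x).
have -> : @PhiN R = fun y => (\int[mu]_(t in `]-oo, y]) phiN t)%R by [].
split; first exact: dPhi.
by rewrite -derive1E PhiE.
Qed.

Lemma cvg_PhiNN : PhiN (- x) @[x --> +oo] --> (0 : R).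
Proof.
(* The identity, seen as a random variable under [normal_prob 0 1], has [PhiN] as its cdf up to
   [fine], and a cdf tends to 0 at -oo. *)
pose idR : measurableTypeR R -> R := idfun.
have midR : measurable_fun setT idR by exact: measurable_id.
pose mixin := isMeasurableFun.Build _ _ _ _ _ midR.
pose X : {RV normal_prob (0 : R) 1 >-> R} := HB.pack idR mixin.
have := cvg_cdfNy0 X.
rewrite cvgNy_compNP => h.
exact: fine_cvg.
Qed.

(** The half-line is where [a + b * w] is nonnegative, so this computes E (a + b W)_+ for W standard
    normal. *)
Lemma integral_affine_phiN a b : 0 < b ->
  (\int[mu]_(w in `[(- (a / b))%R, +oo[) ((a + b * w) * phiN w)%:E =
   (a * PhiN (a / b) + b * phiN (a / b))%:E)%E.
Proof.
(* The primitive of the integrand that vanishes at +oo. *)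
move=> b0; pose F w := - (a * PhiN (- w) + b * phiN w).
have dF w : is_derive w 1 F ((a + b * w) * phiN w).
  have dPhi := is_derive_PhiN (- w).
  have dphi := is_derive_phiN w.
  have dPhiN : is_derive w 1 (fun y => PhiN (- y)) (- phiN w).
    (* By evenness the derivative becomes [phiN (- w) * -1], the shape given by the chain rule. *)
    rewrite -[phiN w]phiN_even -mulrN1.
    exact: (@is_derive1_comp _ (@PhiN R) -%R).
  apply: is_derive_eq.
  by rewrite /GRing.scale /=; ring.
have cF : continuous F.
  move=> w; apply/differentiable_continuous/derivable1_diffP.
  by have [] := dF w.
rewrite (@ge0_continuous_FTC2y _ _ F _ 0).
- by rewrite /F opprK phiN_even sub0e -EFinN opprK.
- move=> w; rewrite lerNl ler_pdivlMr// => aw.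
  by rewrite mulr_ge0 ?phiN_ge0//; lra.
- apply: continuous_subspaceT => w.
  apply: cvgM; last exact: continuous_phiN.
  by apply: cvgD; [exact: cvg_cst|apply: cvgM; [exact: cvg_cst|exact: cvg_id]].
- rewrite -[X in _ --> X]oppr0 -[X in - X](addr0 0).
  apply: cvgN; apply: cvgD.
    by rewrite -[X in _ --> X](mulr0 a); apply: cvgM; [exact: cvg_cst|exact: cvg_PhiNN].
  by rewrite -[X in _ --> X](mulr0 b); apply: cvgM; [exact: cvg_cst|exact: cvg_phiN].
- by move=> w _; have [] := dF w.
- exact/cvg_at_right_filter/cF.
- by move=> w _; rewrite derive1E; have [_] := dF w.
Qed.

Lemma integral_max_affine_phiN a b : b != 0 ->
  (\int[mu]_w (Num.max (a - b * w) 0 * phiN w)%:E =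
   (a * PhiN (a / `|b|) + `|b| * phiN (a / `|b|))%:E)%E.
Proof.
rewrite neq_lt => /orP[b0|b0].
  (* For [b < 0] the positive part lives on [w >= a / b], already a half-line of the required form
     with slope [- b]. *)
  rewrite (ltr0_norm b0) -integral_affine_phiN ?oppr_gt0//.
  rewrite [RHS]integral_mkcond; apply: eq_integral => w _.
  rewrite patchE; case: ifPn; rewrite ?inE ?notin_setE /= in_itv /= andbT.
    move=> wab; rewrite mulNr max_l// subr_ge0 -ler_ndivrMl// mulrC.
    by rewrite (le_trans _ wab)// invrN mulrN opprK.
  move=> /negP; rewrite -ltNge invrN mulrN opprK => wab.
  by rewrite max_r ?mul0r// subr_le0 ltW// -ltr_ndivlMl// mulrC.
rewrite (gtr0_norm b0) -integral_affine_phiN//.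
(* For [b > 0] it lives on [w <= a / b], to be reflected by [w -> - w]; the double negation gives
   the bound the form that this substitution expects. *)
transitivity (\int[mu]_(w in `]-oo, (- - (a / b))%R]) ((a - b * w) * phiN w)%:E)%E.
  rewrite [RHS]integral_mkcond; apply: eq_integral => w _.
  rewrite patchE opprK; case: ifPn; rewrite ?inE ?notin_setE /= in_itv /=.
    by move=> wab; rewrite max_l// subr_ge0 mulrC -ler_pdivlMr.
  move=> /negP; rewrite -ltNge => wab.
  by rewrite max_r ?mul0r// subr_le0 ltW// mulrC -ltr_pdivrMr.
rewrite ge0_integration_by_substitutionNy.
- apply: eq_integral => w _ /=.
  by rewrite phiN_even mulrN opprK.
- apply: continuous_subspaceT => w.
  apply: cvgM; last exact: continuous_phiN.
  by apply: cvgB; [exact: cvg_cst|apply: cvgM; [exact: cvg_cst|exact: cvg_id]].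
- move=> w; rewrite in_itv /= opprK => /ltW wab.
  by rewrite mulr_ge0 ?phiN_ge0// subr_ge0 mulrC -ler_pdivlMr.
Qed.

End standard_normal.

(** * Reduction of a general normal law to the standard one *)

Lemma normal_pdf_standardize (R : realType) (m s x : R) : 0 < s ->
  normal_pdf m s x = phiN ((x - m) / s) / s.
Proof.
move=> s0; rewrite phiNE normal_pdfE ?gt_eqF// /normal_fun.
have -> : normal_peak s = normal_peak 1 / s.
  rewrite /normal_peak expr1n mul1r -mulrnAr sqrtrM ?sqr_ge0//.
  by rewrite sqrtr_sqr gtr0_norm// invfM mulrC.
rewrite mulrAC; congr (_ * expR _ / _).
by field; rewrite gt_eqF.
Qed.

(** In the substitution [x = m + s * w] the derivative [s] cancels the factor [1 / s] of the
    standardized density. Continuity of [g] makes the integrand continuous, as the substitution rule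
    asks. *)
Lemma ge0_integral_normal_standardize (R : realType) (m s : R) (g : R -> R) :
  0 < s -> continuous g -> (forall x, 0 <= g x) ->
  (\int[normal_prob m s]_x (g x)%:E =
   \int[lebesgue_measure]_w (g (m + s * w) * phiN w)%:E)%E.
Proof.
move=> s0 cg g0; pose F w := m + s * w.
have dF (w : R) : is_derive w 1 F s.
  by apply: is_derive_eq; rewrite add0r mul1r scaler1.
have F'E : F^`()%classic = cst s.
  by apply/funext => w; rewrite derive1E; have [_] := dF w.
rewrite ge0_integral_normal_prob.
- under eq_integral do rewrite -EFinM.
  rewrite (@increasing_ge0_integration_by_substitutionT _ F).
  + apply: eq_integral => w _; congr EFin.
    rewrite F'E !fctE /= normal_pdf_standardize// -mulrA divfK ?gt_eqF//.
    by congr (_ * phiN _); rewrite /F; field; rewrite gt_eqF.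
  + by move=> x y xy; rewrite /F ltrD2l ltr_pM2l.
  + by rewrite F'E => ?; exact: cvg_cst.
  + by rewrite F'E; exact: is_cvg_cst.
  + by rewrite F'E; exact: is_cvg_cst.
  + by move=> w; have [] := dF w.
  + apply: (cvg_comp (fun w => s * w) (fun w => m + w)).
      by apply: gt0_cvgMrNy => //; exact: cvg_id.
    exact: cvg_addrl_Ny.
  + apply: (cvg_comp (fun w => s * w) (fun w => m + w)).
      by apply: gt0_cvgMry => //; exact: cvg_id.
    exact: cvg_addrl.
  + move=> x; apply: cvgM; first exact: cg.
    by apply: continuous_normal_pdf; rewrite gt_eqF.
  + by move=> x; rewrite mulr_ge0 ?normal_pdf_ge0.
- by apply/measurable_EFinP; exact: continuous_measurable_fun.
- by move=> x; rewrite lee_fin.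
Qed.

(** Standardizing turns [c - t * y] into [(c - t * m) - (t * s) * w], whose slope is nonzero with
    absolute value [|t| * s]. *)
Lemma integral_max_affine_normal (R : realType) (m s c t : R) :
  0 < s -> t != 0 ->
  (\int[normal_prob m s]_y (Num.max (c - t * y) 0)%:E =
   ((c - t * m) * PhiN ((c - t * m) / (`|t| * s))
    + `|t| * s * phiN ((c - t * m) / (`|t| * s)))%:E)%E.
Proof.
move=> s0 t0; rewrite (@ge0_integral_normal_standardize _ _ _
  (fun y => Num.max (c - t * y) 0))//.
- rewrite -(gtr0_norm s0) -normrM -integral_max_affine_phiN.
    apply: eq_integral => w _; congr (Num.max _ _ * _)%:E.
    by rewrite (gtr0_norm s0); ring.
  by rewrite mulf_neq0// gt_eqF.
- move=> y; apply: (@continuous_max _ _ (fun y => c - t * y) (cst 0));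
    last exact: cvg_cst.
  by apply: cvgB; [exact: cvg_cst|apply: cvgM; [exact: cvg_cst|exact: cvg_id]].
- by move=> y; rewrite le_max lexx orbT.
Qed.

Theorem mainTheorem4 (d : measure_display) (T : measurableType d)
  (R : realType) (P : probability T R)
  (X : Type) (mu1 mu2 sigma1 sigma2 z0 : X -> R)
  (Z1 Z2 : X -> {RV P >-> R}) (x : X) (fstar : R)
  (sigma1_ge0 : 0 <= sigma1 x) (sigma1_sqr : sigma1 x ^+ 2 = 1)
  (sigma2_gt0 : 0 < sigma2 x)
  (Z1_law : normal_law (Z1 x) (mu1 x) (sigma1 x))
  (Z2_law : normal_law (Z2 x) (mu2 x) (sigma2 x))
  (Z_indep : independent_RV (Z1 x) (Z2 x)) :
  NEI P fstar (fun w : T => Z1 x w * Z2 x w + z0 x) =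
  (\int[lebesgue_measure]_(t in [set~ 0%R])
    ((fstar - z0 x - t * mu2 x) * phiN (u1 (mu1 x) (sigma1 x) t)
        * PhiN (u2 (mu2 x) (sigma2 x) (z0 x) fstar t)
     + `|t| * sigma2 x * phiN (u1 (mu1 x) (sigma1 x) t)
        * phiN (u2 (mu2 x) (sigma2 x) (z0 x) fstar t))%:E)%E.
Proof.
have sigma1E : sigma1 x = 1.
  by apply/eqP; rewrite -(@eqrXn2 _ 2)// sigma1_sqr expr1n.
pose f (ab : R * R) := (Num.max (fstar - z0 x - ab.1 * ab.2) 0)%:E.
have f0 ab : (0 <= f ab)%E by rewrite lee_fin le_max lexx orbT.
have mf : measurable_fun [set: R * R] f.
  apply/measurable_EFinP; apply: measurable_maxr => //.
  by apply: measurable_funB => //; exact: measurable_funM.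
transitivity (\int[P]_w f (Z1 x w, Z2 x w))%E.
  rewrite /NEI unlock; apply: eq_integral => w _.
  by congr (Num.max _ _)%:E => /=; ring.
rewrite ge0_integral_independent_RV//.
(* The inner expectation. Its measurability comes from Tonelli and passes to the integral against
   the law of [Z2 x], which has the same values. *)
pose g a := (\int[normal_prob (mu2 x) (sigma2 x)]_b f (a, b))%E.
have mg : measurable_fun setT g.
  exact: (@measurable_fun_fubini_tonelli_F _ _ _ _ _
    (normal_prob (mu2 x) (sigma2 x))).
have g0 a : (0 <= g a)%E by exact: integral_ge0.
rewrite (ge0_integral_normal_law Z1_law)//; last 2 first.
  apply: eq_measurable_fun mg => a _; rewrite (ge0_integral_normal_law Z2_law)//.
  exact: measurableT_comp.
  by move=> a; exact: integral_ge0.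
transitivity (\int[normal_prob (mu1 x) (sigma1 x)]_a g a)%E.
  apply: eq_integral => a _; rewrite (ge0_integral_normal_law Z2_law)//.
  exact: measurableT_comp.
(* The point 0 is Lebesgue-null; it is removed because the closed form of [g t] divides by
   [|t| * sigma2 x]. *)
rewrite ge0_integral_normal_prob// -(@integral_setD1 _ _ 0).
- rewrite setTD; apply: eq_integral => t; rewrite inE /= => /eqP t0.
  rewrite /g integral_max_affine_normal// -EFinM; congr EFin.
  rewrite sigma1E normal_pdf_standardize// divr1 /u1 /u2 divr1.
  ring.
- exact: measurableD.
- apply: measurable_funTS; apply: emeasurable_funM => //.
  by apply/measurable_EFinP; exact: measurable_normal_pdf.
Qed.
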